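(* Let $\Omega$ be an infinite set, and let $J$ be any set of cardinality $\le\mathrm{card}(\Omega)$. Then $L^{=}_{\mathrm{Sym}(\Omega),J}$ contains no chains with $>\mathrm{card}(\Omega)$ jumps. Hence the same is true of $L^{=}_{G,J}$ for any group $G$ embeddable in $\mathrm{Sym}(\Omega)$. Likewise, $L^{=}_{\mathrm{Self}(\Omega),J}$ contains no chains with $>\mathrm{card}(\Omega)$ jumps; hence the same is true of $L^{=}_{M,J}$ for any monoid $M$ embeddable in $\mathrm{Self}(\Omega)$. In particular, for $G$ a group embeddable in $\mathrm{Sym}(\Omega)$ or $M$ a monoid embeddable in $\mathrm{Self}(\Omega)$, the lattice $L^{=}_{G,J}$, respectively $L^{=}_{M,J}$, contains no well-ordered or reverse-well-ordered chain of cardinality $>\mathrm{card}(\Omega)$.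
   Context: $\mathrm{Sym}(\Omega)$ is the group of all permutations of $\Omega$; $\mathrm{Self}(\Omega)$ is the monoid of all maps $\Omega\to\Omega$ under composition. For an algebra $A$ in a variety $\mathbf{V}$ (here: groups, respectively monoids) and a set $J$, a principal solution set in $A^J$ is a set of the form $S_{v=w}=\{a=(a_j)_{j\in J}\in A^J\mid v(a)=w(a)\}$, where $v$ and $w$ are words in a $J$-tuple of variables $(t_j)_{j\in J}$, constants from $A$, and the operations of $\mathbf{V}$ (for groups these include inversion). A solution set in $A^J$ is the intersection of an arbitrary family of principal solution sets (the empty intersection being $A^J$). $L^{=}_{A,J}$ denotes the complete lattice of all solution sets in $A^J$, ordered by inclusion. A chain is a totally ordered subset. A jump in a totally ordered set $C$ is a pair of elements $x<y$ of $C$ such that no $z\in C$ satisfies $x<z<y$. Monoid embeddings preserve the identity element. *)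

(* Defs.v *)
From HB Require Import structures.
From mathcomp Require Import all_boot all_order.
From mathcomp Require Import boolp wochoice classical_sets functions cardinality.

Set Implicit Arguments.
Unset Strict Implicit.
Unset Printing Implicit Defensive.

Import Order.TTheory.

Local Open Scope classical_set_scope.
Local Open Scope card_scope.
Local Open Scope group_scope.

(* In both Self Omega and Sym Omega the product f * g is f \o g. *)

Definition Self (Omega : Type) : Type := Omega -> Omega.

HB.instance Definition _ (Omega : Type) := gen_eqMixin (Self Omega).
HB.instance Definition _ (Omega : Type) := gen_choiceMixin (Self Omega).
HB.instance Definition _ (Omega : Type) :=
  isMonoid.Build (Self Omega) (mul := fun f g => f \o g) (one := id)
    (fun _ _ _ => erefl) (fun _ => erefl) (fun _ => erefl).

Record Sym (Omega : Type) : Type := MkSym {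
  sym_fun :> Omega -> Omega;
  sym_bij : bijective sym_fun
}.

Section SymGroup.
Variable Omega : Type.
Implicit Types s t u : Sym Omega.

HB.instance Definition _ := gen_eqMixin (Sym Omega).
HB.instance Definition _ := gen_choiceMixin (Sym Omega).

Lemma symP s t : sym_fun s =1 sym_fun t -> s = t.
Proof.
case: s t => [f f_bij] [g g_bij] /= /funext fg; subst g.
by rewrite (Prop_irrelevance f_bij g_bij).
Qed.

Lemma sym_inv_subproof s :
  exists g : Omega -> Omega, cancel s g /\ cancel g s.
Proof. by case: (sym_bij s) => g sK gK; exists g. Qed.

Definition sym_inv_fun s : Omega -> Omega := projT1 (cid (sym_inv_subproof s)).

Lemma sym_invK s : cancel s (sym_inv_fun s).
Proof. by rewrite /sym_inv_fun; case: cid => g []. Qed.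

Lemma sym_invKV s : cancel (sym_inv_fun s) s.
Proof. by rewrite /sym_inv_fun; case: cid => g []. Qed.

Definition sym_one : Sym Omega := MkSym (Bijective (frefl id) (frefl id)).
Definition sym_mul s t : Sym Omega := MkSym (bij_comp (sym_bij s) (sym_bij t)).
Definition sym_inv s : Sym Omega := MkSym (Bijective (sym_invKV s) (sym_invK s)).

Lemma sym_mulA : associative sym_mul.
Proof. by move=> s t u; apply: symP. Qed.

Lemma sym_mul1 : left_id sym_one sym_mul.
Proof. by move=> s; apply: symP. Qed.

Lemma sym_mulr1 : right_id sym_one sym_mul.
Proof. by move=> s; apply: symP. Qed.

Lemma sym_mulV : left_inverse sym_one sym_inv sym_mul.
Proof. by move=> s; apply: symP => x; exact: sym_invK. Qed.

Lemma sym_mulrV : right_inverse sym_one sym_inv sym_mul.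
Proof. by move=> s; apply: symP => x; exact: sym_invKV. Qed.

HB.instance Definition _ :=
  isGroup.Build (Sym Omega) sym_mulA sym_mul1 sym_mulr1 sym_mulV sym_mulrV.

End SymGroup.

(* For groups, a monoid morphism automatically commutes with inversion. *)
Definition embeddable (A B : monoidType) : Prop :=
  exists f : A -> B, monoid_morphism f /\ injective f.

Inductive monoid_word (A J : Type) : Type :=
| MVar of J
| MConst of A
| MOne
| MMul of monoid_word A J & monoid_word A J.

Fixpoint monoid_eval (A : monoidType) (J : Type) (a : J -> A)
    (w : monoid_word A J) : A :=
  match w with
  | MVar j => a j
  | MConst c => c
  | MOne => 1
  | MMul v w => monoid_eval a v * monoid_eval a w
  end.

Inductive group_word (A J : Type) : Type :=
| GVar of J
| GConst of A
| GOne
| GMul of group_word A J & group_word A J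
| GInv of group_word A J.

Fixpoint group_eval (A : groupType) (J : Type) (a : J -> A)
    (w : group_word A J) : A :=
  match w with
  | GVar j => a j
  | GConst c => c
  | GOne => 1
  | GMul v w => group_eval a v * group_eval a w
  | GInv w => (group_eval a w)^-1
  end.

Definition monoid_principal (A : monoidType) (J : Type) : set (set (J -> A)) :=
  [set S | exists v w : monoid_word A J,
     S = [set a | monoid_eval a v = monoid_eval a w]].

Definition group_principal (A : groupType) (J : Type) : set (set (J -> A)) :=
  [set S | exists v w : group_word A J,
     S = [set a | group_eval a v = group_eval a w]].

(* \bigcap over the empty family is setT. *)
Definition intersections (T : Type) (P : set (set T)) : set (set T) :=
  [set S | exists2 F : set (set T), F `<=` P & S = \bigcap_(X in F) X].

(* The lattices are given by their underlying sets of solution sets; their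
   order is the library's order on set (J -> A), i.e. inclusion (subsetEset). *)
Definition monoid_solution_sets (A : monoidType) (J : Type) :
  set (set (J -> A)) := intersections (@monoid_principal A J).

Definition group_solution_sets (A : groupType) (J : Type) :
  set (set (J -> A)) := intersections (@group_principal A J).

Definition card_lt (T U : Type) (A : set T) (B : set U) : Prop :=
  A #<= B /\ ~ (B #<= A).

Section Chains.
Variables (d : Order.disp_t) (T : porderType d).
Implicit Types (L C : set T).

Definition jumps C : set (T * T) :=
  [set xy | [/\ C xy.1, C xy.2, (xy.1 < xy.2)%O
              & ~ exists z : T, C z /\ (xy.1 < z < xy.2)%O]].

Definition chain_in L C : Prop := C `<=` L /\ chain <=%O [in C].

Definition well_ordered C : Prop := wo_chain <=%O [in C].

Definition reverse_well_ordered C : Prop := wo_chain >=%O [in C].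

Definition no_chain_with_more_jumps (Omega : Type) L : Prop :=
  ~ exists C, chain_in L C /\ card_lt [set: Omega] (jumps C).

Definition no_larger_well_ordered_chain (Omega : Type) L : Prop :=
  ~ exists C, [/\ chain_in L C,
                  well_ordered C \/ reverse_well_ordered C
                & card_lt [set: Omega] C].

End Chains.

(* Main.v *)
(* Let [G] act faithfully on [Omega]. The value of a word at a point of [Omega]
   depends only on finitely many conditions [a j x = y] on the tuple [a] (the
   inverse of [a j] sends [x] to [y] iff [a j y = x]), so solution sets are closed
   in the topology of pointwise convergence. This topology has a base
   indexed by finite sequences of triples in [J * Omega * Omega], hence of
   cardinality at most that of [Omega]. Send a jump [X < Y] of a chain of closed
   sets to a basic open set that meets [Y] but not [X]; if [X < Y] and [X' < Y']
   are distinct jumps then, up to symmetry, [Y <= X'], so an open set missing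
   [X'] cannot meet [Y], and the map is injective. In a well-ordered
   (reverse-well-ordered) chain every element except the largest (smallest) is
   an end of a jump that determines it. *)

Require Import Defs.
From mathcomp Require Import all_boot all_order.
From mathcomp Require Import boolp wochoice classical_sets functions cardinality.

Set Implicit Arguments.
Unset Strict Implicit.
Unset Printing Implicit Defensive.

Import Order.TTheory.

Local Open Scope classical_set_scope.
Local Open Scope card_scope.

(** * Cardinal arithmetic *)

Lemma card_le_fun T U (u0 : U) (A : set T) (B : set U) : A #<= B ->
  exists2 f : T -> U, set_fun A B f & set_inj A f.
Proof.
elim/Ppointed: U => U in u0 B *; first by case: (no u0).
by move=> /pcard_leP/injfunPex.
Qed.

Lemma set_inj_card_le T U (A : set T) (B : set U) (f : T -> U) :
  set_fun A B f -> set_inj A f -> A #<= B.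
Proof.
move=> fAB f_inj; have [g] : $|{injfun A >-> B}| by apply/injfunPex; exists f.
exact: inj_card_le g.
Qed.

(** Any choice function for [R] on [A] is injective there, by the second hypothesis. *)
Lemma card_le_of_rel T U (A : set T) (B : set U) (R : T -> U -> Prop) :
  (forall x, A x -> exists2 y, B y & R x y) ->
  (forall x x' y, A x -> A x' -> R x y -> R x' y -> x = x') -> A #<= B.
Proof.
move=> R_total R_inj; have [->|/set0P[a Aa]] := eqVneq A set0.
  exact: card_ge0.
have [b _ _] := R_total a Aa.
have [f fP] : {f : T -> U & forall x, A x -> B (f x) /\ R x (f x)}.
  apply: (@choice _ _ (fun x y => A x -> B y /\ R x y)) => x.
  case: (pselect (A x)) => [/R_total[y By Rxy]|nAx].
    by exists y.
  by exists b.
apply: (@set_inj_card_le _ _ _ _ f) => [x /fP[]//|x y /set_mem Ax /set_mem Ay].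
have [_ Rx] := fP x Ax; have [_ Ry] := fP y Ay.
by move=> fxy; apply: R_inj Rx _; rewrite ?fxy.
Qed.

(** The graph of a partial injection: one direction is functionality, the other injectivity. *)
Definition one_to_one T U (G : set (T * U)) : Prop :=
  forall p q, G p -> G q -> (p.1 = q.1 <-> p.2 = q.2).

Lemma one_to_one_bigcup T U (F : set (set (T * U))) :
  (forall G, F G -> one_to_one G) -> total_on F subset ->
  one_to_one (\bigcup_(G in F) G).
Proof.
move=> F11 Ftot p q [G FG Gp] [H FH Hq].
by have [GH|HG] := Ftot _ _ FG FH;
  [apply: (F11 H) => //; exact: GH | apply: (F11 G) => //; exact: HG].
Qed.

(** Zorn's lemma gives a maximal partial injection from [A] to [B]. It exhausts [A] or [B], since
    otherwise an unmatched pair [(a, b)] could be added. *)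
Lemma card_le_total T U (A : set T) (B : set U) : A #<= B \/ B #<= A.
Proof.
pose P : set (set (T * U)) := [set G | G `<=` A `*` B /\ one_to_one G].
have [F FP Ftot|G [[GAB G11] Gmax]] := @Zorn_bigcup _ P.
  split=> [p [G /FP[GAB _] /GAB]//|].
  by apply: one_to_one_bigcup => // G /FP[].
have [dom|/existsNP[a /not_implyP[Aa aG]]] :=
    pselect (forall x, A x -> exists y, G (x, y)).
  left; apply: (@card_le_of_rel _ _ _ _ (fun x y => G (x, y))).
    by move=> x /dom[y Gxy]; exists y => //; case: (GAB _ Gxy).
  by move=> x x' y _ _ Gx Gx'; apply/(G11 _ _ Gx Gx').
have [cod|/existsNP[b /not_implyP[Bb bG]]] :=
    pselect (forall y, B y -> exists x, G (x, y)).
  right; apply: (@card_le_of_rel _ _ _ _ (fun y x => G (x, y))).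
    by move=> y /cod[x Gxy]; exists x => //; case: (GAB _ Gxy).
  by move=> y y' x _ _ Gy Gy'; apply/(G11 _ _ Gy Gy').
exfalso; apply: (Gmax (G `|` [set (a, b)])).
  split; first exact: subsetUl.
  by move=> /(_ (a, b) (or_intror erefl)) Gab; apply: aG; exists b.
split; first by move=> p [/GAB//|->].
move=> [x y] [x' y'] [Gp|[-> ->]] [Gq|[-> ->]] /=.
- exact: G11 Gp Gq.
- by split=> E; [case: aG; exists y | case: bG; exists x]; rewrite -E.
- by split=> E; [case: aG; exists y' | case: bG; exists x']; rewrite E.
- by [].
Qed.

(** * Squares of infinite sets *)

Definition pairing_on T U (A : set T) (B : set U) (h : T -> T -> U) : Prop :=
  (forall x y, A x -> A y -> B (h x y)) /\
  (forall x y x' y', A x -> A y -> A x' -> A y' ->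
     h x y = h x' y' -> x = x' /\ y = y').

(** In cardinals, [A + B <= A * A <= A], hence [(A + B) * (A + B) <= A * A <= A]. *)
Lemma pairing_on_setU T (A B : set T) (h : T -> T -> T) (a0 a1 : T) :
  A a0 -> A a1 -> a0 <> a1 -> pairing_on A A h -> B #<= A ->
  exists h' : T -> T -> T, pairing_on (A `|` B) A h'.
Proof.
move=> Aa0 Aa1 a01 [hA h_inj] BA; have [g gBA g_inj] := card_le_fun a0 BA.
(* [h (c x) (pi x)] codes [x \in A `|` B] in [A]: [c] tells apart [A] and
   [B `\` A], and [pi] is injective on each of them. *)
pose c x := if x \in A then a0 else a1.
pose pi x := if x \in A then x else g x.
have cA x : A (c x) by rewrite /c; case: ifP.
have piA x : (A `|` B) x -> A (pi x).
  rewrite /pi; case: ifPn => [/set_mem//|/negP nAx] [/mem_set//|Bx].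
  exact: gBA.
have code_inj x y : (A `|` B) x -> (A `|` B) y ->
    c x = c y -> pi x = pi y -> x = y.
  rewrite /c /pi.
  case: ifPn => [/set_mem Ax|/negP nAx]; case: ifPn => [/set_mem Ay|/negP nAy] //.
    by move=> _ _ /esym/a01.
  by move=> [/mem_set//|Bx] [/mem_set//|By] _; apply: g_inj; exact/mem_set.
pose code x := h (c x) (pi x).
have codeA x : (A `|` B) x -> A (code x) by move=> Dx; exact: hA (cA x) (piA _ Dx).
exists (fun x y => h (code x) (code y)); split=> [x y Dx Dy|x y x' y' Dx Dy Dx' Dy'].
  by apply: hA; exact: codeA.
move=> /h_inj[]; try exact: codeA.
move=> /h_inj[]; try solve [exact: cA | exact: piA].
move=> cx px /h_inj[]; try solve [exact: cA | exact: piA].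
by move=> cy py; split; apply: code_inj.
Qed.

(* The graph of an injection [A * A -> A] is a [pairing_graph], and [A] is its
   [square_field]; a maximal such graph gives [T * T <= A]. *)
Definition square_field T (G : set (T * T * T)) : set T :=
  [set x | exists z, G (x, x, z)].

Definition pairing_graph T (G : set (T * T * T)) : Prop :=
  [/\ one_to_one G,
      forall x y, square_field G x -> square_field G y -> exists z, G (x, y, z) &
      forall x y z, G (x, y, z) ->
        [/\ square_field G x, square_field G y & square_field G z]].

Lemma square_fieldS T (G H : set (T * T * T)) :
  G `<=` H -> square_field G `<=` square_field H.
Proof. by move=> GH x [z /GH]; exists z. Qed.

Lemma pairing_graph_bigcup T (F : set (set (T * T * T))) :
  F `<=` @pairing_graph T -> total_on F subset ->
  pairing_graph (\bigcup_(G in F) G).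
Proof.
move=> FP Ftot; split.
- by apply: one_to_one_bigcup => // G /FP[].
- move=> x y [u [G FG Gu]] [v [H FH Hv]].
  (* The two points lie in the fields of [G] and [H], hence both in the field of the larger one. *)
  have [K [FK GK HK]] : exists K, [/\ F K, G `<=` K & H `<=` K].
    by have [GH|HG] := Ftot _ _ FG FH; [exists H; split | exists G; split].
  have [_ Ktot _] := FP _ FK.
  have [||z Kz] := Ktot x y; [by exists u; exact: GK | by exists v; exact: HK |].
  by exists z; exists K.
- move=> x y z [G FG Gz]; have [_ _ /(_ _ _ _ Gz)[Gx Gy Gz']] := FP _ FG.
  by have sG := square_fieldS (@bigcup_sup _ _ G F id FG); split; exact: sG.
Qed.

(** The seed for Zorn's lemma: the coding [pickle] of pairs of naturals, carried along [j]. *)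
Lemma pairing_graph_nat T (j : nat -> T) : injective j ->
  pairing_graph [set (j p.1, j p.2, j (pickle p)) | p in [set: nat * nat]].
Proof.
move=> j_inj; set G := image _ _.
have fieldG n : square_field G (j n) by exists (j (pickle (n, n))); exists (n, n).
split.
- move=> _ _ [[m n] _ <-] [[m' n'] _ <-] /=; split.
    by move=> [/j_inj-> /j_inj->].
  by move=> /j_inj /(pcan_inj pickleK_inv) [-> ->].
- move=> _ _ [_ [[m ?] _ [<- _ _]]] [_ [[n ?] _ [<- _ _]]].
  by exists (j (pickle (m, n))); exists (m, n).
- by move=> x y z [[m n] _ [<- <- <-]].
Qed.

Lemma pairing_graph_fun T (G : set (T * T * T)) : pairing_graph G ->
  exists h : T -> T -> T,
    (forall x y, square_field G x -> square_field G y -> G (x, y, h x y)).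
Proof.
move=> [_ Gtot _].
have [h hP] : {h : T * T -> T & forall p,
    square_field G p.1 -> square_field G p.2 -> G (p, h p)}.
  apply: (@choice _ _ (fun p z => square_field G p.1 -> square_field G p.2 ->
    G (p, z))) => -[x y] /=.
  case: (pselect (square_field G x /\ square_field G y)) => [[Gx Gy]|nG].
    by have [z] := Gtot _ _ Gx Gy; exists z.
  by exists x => Gx Gy; case: nG.
by exists (fun x y => h (x, y)) => x y; apply: (hP (x, y)).
Qed.

(** Let [A] be the field of a maximal pairing graph. If the complement of [A] injects into [A], the
    pairing extends to all of [T]. Otherwise the complement contains a copy [B] of [A], and
    extending the graph to the union of [A] and [B] contradicts maximality. *)
Lemma infinite_pairing T : infinite_set [set: T] ->
  exists h : T -> T -> T, forall x y x' y', h x y = h x' y' -> x = x' /\ y = y'.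
Proof.
move=> Tinf; have [t0 _] : [set: T] !=set0 by apply: infinite_setN0.
have [j _ j_inj] := card_le_fun t0 ((infiniteP _).1 Tinf).
have {}j_inj : injective j by move=> x y; apply: j_inj; exact/mem_set.
have G0P := pairing_graph_nat j_inj; set G0 := image _ _ in G0P.
pose P : set (set (T * T * T)) :=
  [set G | G = set0 \/ (G0 `<=` G /\ pairing_graph G)].
have [F FP Ftot|G [[G_eq0|[G0G GP]] Gmax]] := @Zorn_bigcup _ P.
- have [F0|/existsNP[H /not_implyP[FH H_neq0]]] :=
      pselect (forall H, F H -> H = set0).
    by left; apply: bigcup0.
  right; split.
    have [//|[G0H _]] := FP _ FH; apply: subset_trans G0H _.
    exact: bigcup_sup.
  rewrite (_ : \bigcup_(X in F) X = \bigcup_(X in F `&` [set X | X <> set0]) X).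
    apply: pairing_graph_bigcup => [X [/FP[//|[_ XP]] _]//|X Y [FX _] [FY _]].
    exact: Ftot.
  apply/seteqP; split=> [p [X FX Xp]|p [X [FX _] Xp]]; last by exists X.
  by exists X => //; split=> // X0; rewrite X0 in Xp.
- exfalso; apply: (Gmax G0); last by right; split.
  by rewrite G_eq0; split=> // /(_ _ (ex_intro2 _ _ (0, 0) I erefl)).
set A := square_field G.
have [h hG] := pairing_graph_fun GP; have [G11 _ Gcl] := GP.
have hA : pairing_on A A h.
  split=> [x y Ax Ay|x y x' y' Ax Ay Ax' Ay' hxy].
    by case: (Gcl _ _ _ (hG _ _ Ax Ay)).
  by have /= := (G11 _ _ (hG _ _ Ax Ay) (hG _ _ Ax' Ay')).2 hxy; case.
have Aj n : A (j n).
  by apply: (square_fieldS G0G); exists (j (pickle (n, n))); exists (n, n).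
have j01 : j 0 <> j 1 by move=> /j_inj.
have [nA_le_A|A_le_nA] := card_le_total (~` A) A.
  have [q] := pairing_on_setU (Aj 0) (Aj 1) j01 hA nA_le_A.
  by rewrite setUv => -[_ q_inj]; exists q => x y x' y'; exact: q_inj.
have [i iA i_inj] := card_le_fun t0 A_le_nA.
set B := i @` A.
have AB x : A x -> ~ B x by move=> Ax [y Ay yx]; apply: (iA y Ay); rewrite yx.
have B_le_A : B #<= A by exact: card_image_le.
have [q [qA q_inj]] := pairing_on_setU (Aj 0) (Aj 1) j01 hA B_le_A.
pose e x y := i (q x y).
have eB x y : (A `|` B) x -> (A `|` B) y -> B (e x y).
  by move=> Dx Dy; exists (q x y) => //; exact: qA.
have e_inj x y x' y' : (A `|` B) x -> (A `|` B) y -> (A `|` B) x' ->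
    (A `|` B) y' -> e x y = e x' y' -> x = x' /\ y = y'.
  by move=> Dx Dy Dx' Dy' /i_inj eq_q; apply: q_inj => //;
    apply: eq_q; apply/mem_set/qA.
(* The new pairs get values in [B], which is disjoint from [A], so they cannot clash with the values
   of [G]. *)
pose E : set (T * T * T) :=
  [set p | [/\ (A `|` B) p.1.1, (A `|` B) p.1.2, ~ (A p.1.1 /\ A p.1.2) &
               p.2 = e p.1.1 p.1.2]].
have fieldGE : square_field (G `|` E) = A `|` B.
  apply/seteqP; split=> [x [z [Gz|[]//]]|x [Ax|Bx]].
  - by left; exists z.
  - by exists (h x x); left; exact: hG.
  - exists (e x x); right; split=> //=; [by right|by right|].
    by move=> [/AB].
exfalso; apply: (Gmax (G `|` E)).
  split; first exact: subsetUl.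
  pose b := i (j 0); have Bb : B b by exists (j 0).
  move=> /(_ (b, b, e b b)) GE; apply: (AB _ _ Bb); exists (e b b).
  by apply: GE; right; split=> /=; [by right|by right|move=> [/AB]|].
right; split; first by apply: subset_trans G0G _; exact: subsetUl.
split.
- move=> [[x y] z] [[x' y'] z'] [Gp|[/= Dx Dy nA ->]] [Gq|[/= Dx' Dy' nA' ->]] /=.
  + exact: G11 Gp Gq.
  + have [Ax Ay Az] := Gcl _ _ _ Gp; split=> [[xx' yy']|zz'].
      by case: nA'; rewrite -xx' -yy'.
    by case: (AB _ Az); rewrite zz'; apply: eB.
  + have [Ax Ay Az] := Gcl _ _ _ Gq; split=> [[xx' yy']|zz'].
      by case: nA; rewrite xx' yy'.
    by case: (AB _ Az); rewrite -zz'; apply: eB.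
  + split=> [[-> ->]//|/e_inj H].
    by have [||||-> ->] := H.
- rewrite fieldGE => x y Dx Dy.
  have [[Ax Ay]|nA] := pselect (A x /\ A y).
    by exists (h x y); left; exact: hG.
  by exists (e x y); right.
- rewrite fieldGE => x y z [Gp|[/= Dx Dy _ ->]].
    by have [Ax Ay Az] := Gcl _ _ _ Gp; split; left.
  by split=> //; right; exact: eB.
Qed.

Lemma infinite_card_le_option T : infinite_set [set: T] ->
  [set: option T] #<= [set: T].
Proof.
move=> Tinf; have [t0 _] : [set: T] !=set0 by apply: infinite_setN0.
have [h h_inj] := infinite_pairing Tinf.
have [j _ j_inj] := card_le_fun t0 ((infiniteP _).1 Tinf).
have j01 : j 0 <> j 1 by move=> /j_inj -/(_ (in_setT _) (in_setT _)).
(* [Some] goes to the diagonal, [None] to a pair off it. *)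
pose f o := if o is Some x then h x x else h (j 0) (j 1).
apply: (@set_inj_card_le _ _ _ _ f) => // -[x|] [y|] _ _ //= /h_inj[].
- by move=> ->.
- by move=> -> /j01.
- by move=> <- /esym/j01.
Qed.

Lemma infinite_card_le_seq T : infinite_set [set: T] ->
  [set: seq T] #<= [set: T].
Proof.
move=> Tinf; have [t0 _] : [set: T] !=set0 by apply: infinite_setN0.
have [h h_inj] := infinite_pairing Tinf.
have [f _ f_inj] := card_le_fun t0 (infinite_card_le_option Tinf).
have {}f_inj : injective f by move=> x y; apply: f_inj; exact: in_setT.
(* The tags [None] and [Some] keep the codes of empty and nonempty lists apart. *)
pose g := foldr (fun x r => f (Some (h x r))) (f None).
apply: (@set_inj_card_le _ _ _ _ g) => // s t _ _.
by elim: s t => [|x s IHs] [|y t] //= /f_inj // [] /h_inj[-> /IHs->].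
Qed.

(** * Jumps in chains *)

Section Chains.
Variables (d : Order.disp_t) (T : porderType d).
Implicit Types (C : set T).

(** When both alternatives fail, each jump starts strictly below the end of the other; any
    difference between their ends then puts an element of [C] strictly inside one of them. *)
Lemma chain_jumps_lt C : chain <=%O [in C] -> forall p q,
  jumps C p -> jumps C q -> p <> q -> (p.2 <= q.1)%O \/ (q.2 <= p.1)%O.
Proof.
move=> Cchain [x y] [x' y'] [/= Cx Cy xy nC] [/= Cx' Cy' xy' nC'] pq.
have Ctot u v : C u -> C v -> (u <= v)%O \/ (v < u)%O.
  move=> Cu Cv; have /orP[] := Cchain u v (mem_set Cu) (mem_set Cv).
    by left.
  by rewrite le_eqVlt => /orP[/eqP->|]; [left|right].
have [|x'y] := Ctot y x' Cy Cx'; first by left.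
have [|xy''] := Ctot y' x Cy' Cx; first by right.
case: pq; congr (_, _).
  have [xx'|x'x] := Ctot x x' Cx Cx'.
    move: xx'; rewrite le_eqVlt => /orP[/eqP//|xx'].
    by case: nC; exists x'; rewrite xx' x'y.
  by case: nC'; exists x; rewrite x'x xy''.
have [yy'|y'y] := Ctot y y' Cy Cy'.
  move: yy'; rewrite le_eqVlt => /orP[/eqP//|yy'].
  by case: nC'; exists y; rewrite x'y yy'.
by case: nC; exists y'; rewrite xy'' y'y.
Qed.

(** [e] picks an end of a jump; [extremal] covers at most one further element, coded by [None]. *)
Lemma chain_card_le_jumps (Omega : Type) C (e : T * T -> T) (extremal : set T) :
  infinite_set [set: Omega] ->
  (forall x, C x -> extremal x \/ exists2 p, jumps C p & e p = x) ->
  (forall x y, C x -> C y -> extremal x -> extremal y -> x = y) ->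
  jumps C #<= [set: Omega] -> C #<= [set: Omega].
Proof.
move=> Oinf C_ex ex_uniq JO.
apply: card_le_trans (infinite_card_le_option Oinf).
have [w0 _] : [set: Omega] !=set0 by apply: infinite_setN0.
have [f _ f_inj] := card_le_fun w0 JO.
pose R x o := if o is Some w then exists p, [/\ jumps C p, e p = x & f p = w]
              else extremal x.
apply: (@card_le_of_rel _ _ _ _ R) => [x /C_ex[ex_x|[p Jp px]]|x x' [w|]].
- by exists None.
- by exists (Some (f p)) => //; exists p.
- move=> _ _ [p [/mem_set Jp <- <-]] [q [/mem_set Jq <- /esym fpq]].
  by rewrite (f_inj p q).
- exact: ex_uniq.
Qed.

(** When [x] is not the largest element, the least element of [C] above [x] forms a jump with it. *)
Lemma well_ordered_succ C x : well_ordered C -> C x ->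
  (forall y, C y -> (y <= x)%O) \/ exists2 p, jumps C p & p.1 = x.
Proof.
move=> Cwo Cx; pose A : {pred T} := fun y => (y \in C) && (x < y)%O.
have Ctot := wo_chainW Cwo.
have [A_ne|A0] := pselect (nonempty A); last first.
  left=> y Cy; have /orP[//|] := Ctot y x (mem_set Cy) (mem_set Cx).
  rewrite le_eqVlt => /orP[/eqP->//|xy].
  by case: A0; exists y; apply/andP; split; [exact: mem_set|].
have [|z [[/andP[/set_mem Cz xz] zmin] _]] := Cwo A _ A_ne.
  by move=> y /andP[].
right; exists (x, z) => //; split=> //= -[y [Cy /andP[xy yz]]].
have /zmin : y \in A by apply/andP; split; [exact: mem_set|].
by rewrite (lt_geF yz).
Qed.

Lemma reverse_well_ordered_pred C x : reverse_well_ordered C -> C x ->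
  (forall y, C y -> (x <= y)%O) \/ exists2 p, jumps C p & p.2 = x.
Proof.
move=> Cwo Cx; pose A : {pred T} := fun y => (y \in C) && (y < x)%O.
have Ctot := wo_chainW Cwo.
have [A_ne|A0] := pselect (nonempty A); last first.
  left=> y Cy; have /orP[//|/=] := Ctot y x (mem_set Cy) (mem_set Cx).
  rewrite le_eqVlt => /orP[/eqP->//|xy].
  by case: A0; exists y; apply/andP; split; [exact: mem_set|].
(* Minimality is for [>=%O], so [z] is the greatest element of [C] below [x]. *)
have [|z [[/andP[/set_mem Cz xz] zmin] _]] := Cwo A _ A_ne.
  by move=> y /andP[].
right; exists (z, x) => //; split=> //= -[y [Cy /andP[zy yx]]].
have /zmin /= : y \in A by apply/andP; split; [exact: mem_set|].
by rewrite (lt_geF zy).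
Qed.

Lemma few_jumps_few_well_ordered (Omega : Type) (L : set T) :
  infinite_set [set: Omega] ->
  (forall C, chain_in L C -> jumps C #<= [set: Omega]) ->
  no_larger_well_ordered_chain Omega L.
Proof.
move=> Oinf LJ [C [/LJ JO Cwo [_ ]]]; apply.
case: Cwo => Cwo.
- apply: (chain_card_le_jumps Oinf _ _ JO) => [x|x y Cx Cy xmax ymax].
    exact: well_ordered_succ.
  by apply/le_anti; rewrite xmax // ymax.
- apply: (chain_card_le_jumps Oinf _ _ JO) => [x|x y Cx Cy xmin ymin].
    exact: reverse_well_ordered_pred.
  by apply/le_anti; rewrite xmin // ymin.
Qed.

End Chains.

(** The second hypothesis says that the complement of each member of [C] is a union of sets
    [U i]. *)
Lemma chain_jumps_card_le X I (U : I -> set X) (C : set (set X)) :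
  chain <=%O [in C] ->
  (forall S, C S -> forall a, ~ S a -> exists2 i, U i a & S `&` U i = set0) ->
  jumps C #<= [set: I].
Proof.
move=> Cchain Ccl.
apply: (@card_le_of_rel _ _ _ _
    (fun p i => p.1 `&` U i = set0 /\ p.2 `&` U i !=set0)).
  move=> [S S'] [/= CS CS' + _]; rewrite properEset => -[_ /existsNP[a]].
  move=> /not_implyP[S'a Sa].
  have [i Uia SUi] := Ccl S CS a Sa.
  by exists i => //; split=> //; exists a.
move=> p q i Jp Jq [p1 [a [p2a Ua]]] [q1 [b [q2b Ub]]].
apply: contra_notP (fun f : False => f) => pq.
have [] := chain_jumps_lt Cchain Jp Jq pq; rewrite subsetEset => sub.
(* The point [a] of [U i] lies in [p.2], hence in [q.1], which misses [U i]. *)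
- by rewrite -[False]/(set0 a) -q1; split=> //; exact: sub.
- by rewrite -[False]/(set0 b) -p1; split=> //; exact: sub.
Qed.

(** * Solution sets are closed *)

(* Subbasic conditions [a j x = y] generate the topology of pointwise
   convergence; a list of triples [(j, x, y)] is a basic open set. *)
Section Action.
Variables (A J Omega : Type) (act : A -> Omega -> Omega).

Fixpoint basic_open (s : seq (J * Omega * Omega)) : set (J -> A) :=
  if s is (j, x, y) :: s' then [set a | act (a j) x = y] `&` basic_open s'
  else setT.

Lemma basic_open_cat s t :
  basic_open (s ++ t) = basic_open s `&` basic_open t.
Proof.
by elim: s => [|[[j x] y] s IHs] /=; rewrite ?setTI // IHs setIA.
Qed.

(** Continuity of [F] for pointwise convergence, with [Omega] discrete. *)
Definition locally_determined (F : (J -> A) -> A) : Prop :=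
  forall a x, exists2 s, basic_open s a &
    forall b, basic_open s b -> act (F b) x = act (F a) x.

Lemma locally_determined_var j : locally_determined (fun a => a j).
Proof. by move=> a x; exists [:: (j, x, act (a j) x)] => // b []. Qed.

Lemma locally_determined_cst c : locally_determined (fun=> c).
Proof. by move=> a x; exists [::]. Qed.

Definition basic_closed (S : set (J -> A)) : Prop :=
  forall a, ~ S a -> exists2 s, basic_open s a & S `&` basic_open s = set0.

(** By faithfulness, distinct [F a] and [G a] differ at some point [x], and finitely many conditions
    on the tuple fix both values at [x]. *)
Lemma basic_closed_eq F G : injective act ->
  locally_determined F -> locally_determined G ->
  basic_closed [set a | F a = G a].
Proof.
move=> act_inj Fld Gld a /= FG.
have [x Fx_neq] : exists x, act (F a) x <> act (G a) x.
  by apply/existsNP => /funext/act_inj.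
have [[s sa Fs] [t ta Gt]] := (Fld a x, Gld a x).
exists (s ++ t); rewrite basic_open_cat //.
apply/seteqP; split=> // b [/= FGb [sb tb]].
by apply: Fx_neq; rewrite -(Fs b sb) -(Gt b tb) FGb.
Qed.

Lemma basic_closed_intersections (P : set (set (J -> A))) S :
  P `<=` basic_closed -> intersections P S -> basic_closed S.
Proof.
move=> Pcl [F FP ->] a /existsNP[X /not_implyP[FX Xa]].
have [s sa Xs] := Pcl X (FP X FX) a Xa.
exists s => //; apply/seteqP; split=> // b [Fb sb].
by rewrite -Xs; split=> //; exact: Fb.
Qed.

Lemma basic_closed_few_jumps (C : set (set (J -> A))) :
  infinite_set [set: Omega] -> [set: J] #<= [set: Omega] ->
  chain <=%O [in C] -> C `<=` basic_closed -> jumps C #<= [set: Omega].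
Proof.
move=> Oinf J_le Cchain Ccl.
apply: card_le_trans (chain_jumps_card_le Cchain Ccl) _.
apply: card_le_trans (infinite_card_le_seq Oinf).
have [w0 _] : [set: Omega] !=set0 by apply: infinite_setN0.
have [f _ f_inj] := card_le_fun w0 J_le.
have [h h_inj] := infinite_pairing Oinf.
(* Triples are coded in [Omega] by injecting [J] and pairing twice. *)
pose g (p : J * Omega * Omega) := h (h (f p.1.1) p.1.2) p.2.
apply: (@set_inj_card_le _ _ _ _ (map g)) => // s t _ _; apply: inj_map.
move=> [[j x] y] [[j' x'] y'] /h_inj[/h_inj[/= fj -> ->]].
by rewrite (f_inj j j' _ _ fj) //; exact: in_setT.
Qed.

End Action.

(** * Continuity of word maps *)

Section Words.
Variables (Omega J : Type).

Lemma locally_determined_mul (M : monoidType) (act : M -> Self Omega)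
    (F G : (J -> M) -> M) : {morph act : x y / (x * y)%g} ->
  locally_determined act F -> locally_determined act G ->
  locally_determined act (fun a => F a * G a)%g.
Proof.
move=> actM Fld Gld a x.
(* The conditions [s] fix the image of [x] under [G], and [t] fixes the value of [F] at that
   image. *)
have [s sa Gs] := Gld a x; have [t ta Ft] := Fld a (act (G a) x).
exists (s ++ t); rewrite basic_open_cat // => b [sb tb].
by rewrite !actM /= -[LHS]/(act (F b) (act (G b) x)) Gs // Ft.
Qed.

Lemma locally_determined_inv (G : groupType) (act : G -> Self Omega)
    (F : (J -> G) -> G) : monoid_morphism act ->
  locally_determined act F -> locally_determined act (fun a => (F a)^-1)%g.
Proof.
move=> [act1 actM] Fld a x.
have actV u v : (u * v = 1)%g -> cancel (act v) (act u).
  by move=> uv1 y; rewrite -[LHS]/((act u * act v)%g y) -actM uv1 act1.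
(* If [F b] agrees with [F a] at the preimage of [x] under [F a], it sends that point to [x], so the
   inverses agree at [x]. *)
have [s sa Fs] := Fld a (act (F a)^-1%g x).
exists s => // b /Fs; rewrite (actV _ _ (mulgV _)) => E.
by rewrite -[in LHS]E (actV _ _ (mulVg _)).
Qed.

Lemma monoid_solution_set_closed (M : monoidType) (act : M -> Self Omega) S :
  monoid_morphism act -> injective act ->
  @monoid_solution_sets M J S -> basic_closed act S.
Proof.
move=> [_ actM] act_inj; apply: basic_closed_intersections => _ [v [w ->]].
have ld (u : monoid_word M J) : locally_determined act (fun a => monoid_eval a u).
  elim: u => [j|c||u IHu u' IHu'] /=.
  - exact: locally_determined_var.
  - exact: locally_determined_cst.
  - exact: locally_determined_cst.
  - exact: locally_determined_mul.
exact: basic_closed_eq.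
Qed.

Lemma group_solution_set_closed (G : groupType) (act : G -> Self Omega) S :
  monoid_morphism act -> injective act ->
  @group_solution_sets G J S -> basic_closed act S.
Proof.
move=> actM act_inj; apply: basic_closed_intersections => _ [v [w ->]].
have ld (u : group_word G J) : locally_determined act (fun a => group_eval a u).
  elim: u => [j|c||u IHu u' IHu'|u IHu] /=.
  - exact: locally_determined_var.
  - exact: locally_determined_cst.
  - exact: locally_determined_cst.
  - exact: (locally_determined_mul actM.2).
  - exact: locally_determined_inv.
exact: basic_closed_eq.
Qed.

End Words.

(** * From embeddings to faithful actions on [Omega] *)

Lemma embeddable_refl (A : monoidType) : embeddable A A.
Proof. by exists id; split. Qed.

Lemma embeddable_Sym_Self (Omega : Type) (G : groupType) :
  embeddable G (Sym Omega) -> embeddable G (Self Omega).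
Proof.
move=> [f [[f1 fM] f_inj]]; exists (fun x => sym_fun (f x)).
split; first by split=> [|x y]; rewrite ?f1 ?fM.
by move=> x y fxy; apply/f_inj/symP; rewrite fxy.
Qed.

Theorem theorem5p4 (Omega : Type) (Omega_inf : infinite_set [set: Omega])
    (J : Type) (J_le : [set: J] #<= [set: Omega]) :
  (no_chain_with_more_jumps Omega (@group_solution_sets (Sym Omega) J) /\
   forall G : groupType, embeddable G (Sym Omega) ->
     no_chain_with_more_jumps Omega (@group_solution_sets G J)) /\
  (no_chain_with_more_jumps Omega (@monoid_solution_sets (Self Omega) J) /\
   forall M : monoidType, embeddable M (Self Omega) ->
     no_chain_with_more_jumps Omega (@monoid_solution_sets M J)) /\
  (forall G : groupType, embeddable G (Sym Omega) ->
     no_larger_well_ordered_chain Omega (@group_solution_sets G J)) /\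
  (forall M : monoidType, embeddable M (Self Omega) ->
     no_larger_well_ordered_chain Omega (@monoid_solution_sets M J)).
Proof.
(* The bound is proved as [#<=], the form that the count of well-ordered chains takes as input. *)
have group_few (G : groupType) : embeddable G (Sym Omega) ->
    forall C, chain_in (@group_solution_sets G J) C -> jumps C #<= [set: Omega].
  move=> /embeddable_Sym_Self[act [actM act_inj]] C [CL Cchain].
  apply: (basic_closed_few_jumps (act := act) Omega_inf J_le Cchain) => S /CL.
  exact: group_solution_set_closed.
have monoid_few (M : monoidType) : embeddable M (Self Omega) ->
    forall C, chain_in (@monoid_solution_sets M J) C -> jumps C #<= [set: Omega].
  move=> [act [actM act_inj]] C [CL Cchain].
  apply: (basic_closed_few_jumps (act := act) Omega_inf J_le Cchain) => S /CL.
  exact: monoid_solution_set_closed.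
have group_jumps (G : groupType) : embeddable G (Sym Omega) ->
    no_chain_with_more_jumps Omega (@group_solution_sets G J).
  by move=> /group_few GC [C [/GC JO []]].
have monoid_jumps (M : monoidType) : embeddable M (Self Omega) ->
    no_chain_with_more_jumps Omega (@monoid_solution_sets M J).
  by move=> /monoid_few MC [C [/MC JO []]].
split; first by split=> //; exact: group_jumps (embeddable_refl _).
split; first by split=> //; exact: monoid_jumps (embeddable_refl _).
split=> [G /group_few|M /monoid_few]; exact: few_jumps_few_well_ordered.
Qed.
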